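(* The permutation statistic $\Psi : P \to \mathbb{Z}$ defined by $\Psi(\sigma) = \Lambda(\sigma)$ if $|\sigma| = 4$ and $\Psi(\sigma) = 1$ otherwise is shuffle compatible.
   Context: A permutation $\sigma = \sigma_1\sigma_2\cdots\sigma_n$ of size $|\sigma| = n$ is a finite sequence of $n$ distinct integers (not necessarily $1,\dots,n$). $P_n$ denotes the set of permutations of size $n$, and $P = \bigcup_n P_n$. Two permutations $\sigma, \phi$ of the same size are equivalent, written $\sigma\sim\phi$, if they have the same relative order, i.e. for all $i,j$, $\sigma_i < \sigma_j$ if and only if $\phi_i < \phi_j$. A function $st$ on $P$ is a permutation statistic if $st(\sigma) = st(\phi)$ whenever $\sigma\sim\phi$. Two permutations are disjoint if they have no number in common. For disjoint permutations $\sigma,\phi$, a shuffle of $\sigma$ and $\phi$ is a permutation of size $|\sigma|+|\phi|$ that contains both $\sigma$ and $\phi$ as (not necessarily contiguous) subsequences; $\mathrm{Sh}(\sigma,\phi)$ denotes the set of all shuffles of $\sigma$ and $\phi$. A permutation statistic $st$ is shuffle compatible if for all disjoint permutations $\sigma,\phi$, the multiset $\{\{st(\gamma) \mid \gamma\in \mathrm{Sh}(\sigma,\phi)\}\}$ (one entry for each shuffle $\gamma$, counted with multiplicity) depends only on $st(\sigma)$, $st(\phi)$, $|\sigma|$ and $|\phi|$. That is, if $\sigma,\phi$ are disjoint, $\sigma',\phi'$ are disjoint, $|\sigma|=|\sigma'|$, $|\phi|=|\phi'|$, $st(\sigma)=st(\sigma')$ and $st(\phi)=st(\phi')$, then the two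 multisets coincide. For a permutation $\sigma$ of size $4$ whose entries are $a_1<a_2<a_3<a_4$, define $\mathrm{Inv}_{12}(\sigma) = 1$ if $a_1$ appears to the left of $a_2$ in $\sigma$ and $\mathrm{Inv}_{12}(\sigma) = -1$ otherwise; define $\mathrm{Adj}_{34}(\sigma) = 1$ if $a_3$ and $a_4$ occupy adjacent positions in $\sigma$ (in either order) and $\mathrm{Adj}_{34}(\sigma) = -1$ otherwise; and set $\Lambda(\sigma) = \mathrm{Inv}_{12}(\sigma)\cdot \mathrm{Adj}_{34}(\sigma)$. *)

(* Defs.v *)
From HB Require Import structures.
From mathcomp Require Import all_boot all_order all_algebra.

Set Implicit Arguments.
Unset Strict Implicit.
Unset Printing Implicit Defensive.

Import Order.TTheory GRing.Theory Num.Theory.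
Local Open Scope ring_scope.

(* The set P: finite sequences of distinct integers. *)
Record permutation := Permutation {
  entries :> seq int;
  entries_uniq : uniq entries }.

HB.instance Definition _ := [isSub for entries].
HB.instance Definition _ := [Equality of permutation by <:].

Implicit Types s t g : permutation.

(* Positions are numbered from 0. *)
Definition equivalent s t : Prop :=
  size s = size t /\
  forall i j : nat, (i < size s)%N -> (j < size s)%N ->
    (s`_i < s`_j) <-> (t`_i < t`_j).

Definition permutation_statistic (T : Type) (st : permutation -> T) : Prop :=
  forall s t, equivalent s t -> st s = st t.

Definition disjoint_perm s t : bool := ~~ has (mem (entries s)) t.

Definition is_shuffle s t g : bool :=
  [&& size g == (size s + size t)%N, subseq s g & subseq t g].

(* A shuffle of disjoint s and t rearranges s ++ t, so filtering these
   rearrangements lists each shuffle exactly once: see mem_Sh and Sh_uniq. *)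
Definition Sh s t : seq permutation :=
  [seq g <- pmap insub (permutations (s ++ t)) | is_shuffle s t g].

Lemma Sh_uniq s t : uniq (Sh s t).
Proof. by rewrite filter_uniq // pmap_sub_uniq // permutations_uniq. Qed.

Lemma mem_Sh s t g : disjoint_perm s t -> (g \in Sh s t) = is_shuffle s t g.
Proof.
move=> dst; rewrite mem_filter; case sh: (is_shuffle s t g) => //=.
rewrite mem_pmap_sub mem_permutations.
case/and3P: sh => /eqP szg /mem_subseq sg /mem_subseq tg.
have ust : uniq (s ++ t).
  by rewrite cat_uniq entries_uniq entries_uniq andbT.
have sub : {subset s ++ t <= entries g}.
  by move=> x; rewrite mem_cat => /orP[/sg|/tg].
have [|_ eqm] := uniq_min_size ust sub; first by rewrite szg size_cat.
by rewrite uniq_perm ?entries_uniq // => x; rewrite eqm.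
Qed.

(* perm_eq compares the multisets {{st g | g in Sh s t}}. *)
Definition shuffle_compatible (T : eqType) (st : permutation -> T) : Prop :=
  forall s t s' t' : permutation,
    disjoint_perm s t -> disjoint_perm s' t' ->
    size s = size s' -> size t = size t' ->
    st s = st s' -> st t = st t' ->
    perm_eq [seq st g | g <- Sh s t] [seq st g | g <- Sh s' t'].

(* The i-th smallest entry a_i of s, for 1 <= i <= size s. *)
Definition nth_smallest s (i : nat) : int := (sort <=%R s)`_i.-1.

(* The position in s of a_i. *)
Definition pos s (i : nat) : nat := index (nth_smallest s i) s.

Definition Inv12 s : int := if (pos s 1 < pos s 2)%N then 1 else -1.

Definition Adj34 s : int :=
  if (pos s 3 == (pos s 4).+1) || (pos s 4 == (pos s 3).+1) then 1 else -1.

Definition Lambda s : int := Inv12 s * Adj34 s.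

Definition Psi s : int := if size s == 4%N then Lambda s else 1.

(* Main.v *)
Require Import Defs.
From mathcomp Require Import all_boot all_order all_algebra.

Set Implicit Arguments.
Unset Strict Implicit.
Unset Printing Implicit Defensive.

Import Order.TTheory GRing.Theory Num.Theory.
Local Open Scope ring_scope.

(** A relabelling of the entries by an injection carries shuffles to shuffles,
    so the number of shuffles depends only on the two sizes; an increasing
    relabelling moreover preserves the relative order, hence [Psi].  Let m and
    n be the sizes of the two permutations.

    If m + n differs from 4, then [Psi] is 1 on all shuffles, and the multiset
    is determined by their number.  If m + n = 4 and m = 0 or n = 0, the only
    shuffle is the nonempty permutation itself, so that [Psi] is constant on the
    shuffles and its value is given by the hypothesis.  The content is in the
    remaining cases (1,3), (2,2) and (3,1), where [Psi] carries no information
    on the permutations being shuffled: there [Lambda] takes each of the values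
    1 and -1 on exactly half of the shuffles ([Lambda_balanced]).

    The balance can be seen by hand up to symmetry.  Exchanging the values 1
    and 2, or 3 and 4, or reversing all words multiplies [Lambda] by a constant
    sign.  When 3 or 4 is shuffled with a word on the three other values, Inv12
    is constant and two of the four insertions make 3 and 4 adjacent; 1 shuffled
    with 234 gives 1234 (+), 2134 (-), 2314 (+), 2341 (-), and with 324 the
    values 3 and 4 are never adjacent while 1 precedes 2 in two cases of four.
    For sizes (2,2) it remains to look at 12 with 34, where 3 and 4 are adjacent
    in three shuffles of six, at 13 with 24, where [Lambda] is 1 on 1234, 1243
    and 2413 only, and at 13 with 42, where it is 1 on 1342, 1432 and 4213 only.
    The proof below instead evaluates the finitely many cases on the words in
    0, 1, 2, 3, to which an increasing relabelling reduces all others. *)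

(** * Relabelling the entries of a word *)

(** Between the concatenations of two pairs of words this is the bijection that
    counts shuffles; between sorted words it is a standardization. *)
Definition relabel (u v : seq int) (x : int) : int := v`_(index x u).

Lemma map_relabel u v :
  uniq u -> size u = size v -> [seq relabel u v x | x <- u] = v.
Proof.
move=> uu szuv; apply: (@eq_from_nth _ 0); rewrite size_map // => i iu.
by rewrite (nth_map 0) // /relabel index_uniq.
Qed.

Lemma relabel_inj u v :
  uniq v -> size u = size v -> {in u &, injective (relabel u v)}.
Proof.
move=> uv szuv x y xu yu /eqP.
rewrite nth_uniq -?szuv ?index_mem // => /eqP exy.
by rewrite -(nth_index 0 xu) exy nth_index.
Qed.

Lemma relabel_sorted_homo u v :
    sorted <=%R u -> sorted <%R v -> size u = size v ->
  {in u &, {homo relabel u v : x y / x < y}}.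
Proof.
move=> su sv szuv x y xu yu xy.
apply: (sorted_ltn_nth lt_trans) => //; rewrite ?inE -?szuv ?index_mem //.
rewrite ltnNge; apply: contraL xy => iyx; rewrite -leNgt.
exact: (sorted_leq_index le_trans lexx su).
Qed.

Lemma homo_lt_inj (u : seq int) (f : int -> int) :
  {in u &, {homo f : x y / x < y}} -> {in u &, injective f}.
Proof.
move=> fi x y xu yu fxy; case: (ltgtP x y) => //.
- by move/(fi _ _ xu yu); rewrite fxy ltxx.
- by move/(fi _ _ yu xu); rewrite fxy ltxx.
Qed.

Lemma index_map_in (T1 T2 : eqType) (f : T1 -> T2) (u : seq T1) (x : T1) :
  {in u &, injective f} -> x \in u -> index (f x) (map f u) = index x u.
Proof.
elim: u => //= y u IHu fi xyu; rewrite (inj_in_eq fi) ?mem_head //.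
move: xyu; rewrite inE eq_sym; case: eqP => //= _ xu; rewrite IHu //.
by move=> a b au bu; apply: fi; rewrite inE ?au ?bu orbT.
Qed.

(** * The statistic on words *)

(** [Psi] only reads the entries; on bare words, with no uniqueness proof
    attached, it can be evaluated by computation. *)
Definition word_psi (g : seq int) : int :=
  let p i := index (sort <=%R g)`_i g in
  if size g == 4%N then
    (if (p 0 < p 1)%N then 1 else -1) *
    (if (p 2 == (p 3).+1) || (p 3 == (p 2).+1) then 1 else -1)
  else 1.

Lemma PsiE (g : permutation) : Psi g = word_psi g.
Proof. by []. Qed.

Lemma word_psi_map (f : int -> int) (g : seq int) :
  {in g &, {homo f : x y / x < y}} -> word_psi (map f g) = word_psi g.
Proof.
move=> fi; rewrite /word_psi size_map; case: eqP => // sz4.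
have finj := homo_lt_inj fi.
have sf : sort <=%R (map f g) = map f (sort <=%R g).
  apply: (@homo_sort_map_in _ _ [in g] f <=%R <=%R); last exact/allP.
  - by move=> x y xg yg /= /le_anti; apply: finj.
  - by move=> y x z _ _ _ /=; apply: le_trans.
  - by move=> x y _ _; apply: le_total.
  - exact: ltW_homo_in.
have E i : (i < 4)%N ->
    index (sort <=%R (map f g))`_i (map f g) = index (sort <=%R g)`_i g.
  move=> i4; have isz : (i < size (sort <=%R g))%N by rewrite size_sort sz4.
  rewrite sf (nth_map 0) // index_map_in //.
  by rewrite -(mem_sort <=%R) mem_nth.
by rewrite !E.
Qed.

(** An equivalence of permutations is an increasing relabelling. *)
Lemma Psi_statistic : permutation_statistic Psi.
Proof.
move=> s t [szst eqst]; rewrite !PsiE.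
rewrite -[in RHS](map_relabel (entries_uniq s) szst).
rewrite word_psi_map // => x y xs ys xy.
by apply/eqst; rewrite ?index_mem // !nth_index.
Qed.

(** * Shuffles of words *)

Definition shuffles (s t : seq int) : seq (seq int) :=
  [seq g <- permutations (s ++ t) | subseq s g && subseq t g].

Lemma mem_shuffles s t g :
  (g \in shuffles s t) = [&& subseq s g, subseq t g & perm_eq g (s ++ t)].
Proof. by rewrite mem_filter mem_permutations andbA. Qed.

Lemma shuffles_uniq s t : uniq (shuffles s t).
Proof. by rewrite filter_uniq // permutations_uniq. Qed.

Lemma disjoint_perm_uniq (s t : permutation) :
  disjoint_perm s t -> uniq (s ++ t).
Proof. by move=> dst; rewrite cat_uniq !entries_uniq andbT. Qed.

Lemma entries_Sh (s t : permutation) : disjoint_perm s t ->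
  perm_eq [seq entries g | g <- Sh s t] (shuffles s t).
Proof.
move=> dst; apply: uniq_perm.
- by rewrite map_inj_uniq ?Sh_uniq //; apply: val_inj.
- exact: shuffles_uniq.
move=> g; rewrite mem_shuffles; apply/mapP/and3P => [[h hS ->]|[sg tg pg]].
  move: hS; rewrite mem_filter => /andP[/and3P[_ -> ->]].
  by rewrite mem_pmap_sub mem_permutations.
have ug : uniq g by rewrite (perm_uniq pg) disjoint_perm_uniq.
exists (Permutation ug) => //; rewrite mem_Sh // /is_shuffle /= sg tg.
by rewrite (perm_size pg) size_cat eqxx.
Qed.

Lemma perm_Psi_Sh (s t : permutation) : disjoint_perm s t ->
  perm_eq [seq Psi g | g <- Sh s t] [seq word_psi g | g <- shuffles s t].
Proof. by move=> /entries_Sh/(perm_map word_psi); rewrite -map_comp. Qed.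

Lemma shuffles_map_sub (f : int -> int) s t :
  {subset map (map f) (shuffles s t) <= shuffles (map f s) (map f t)}.
Proof.
move=> _ /mapP[g gS ->]; move: gS; rewrite !mem_shuffles => /and3P[sg tg pg].
by rewrite !map_subseq // -map_cat perm_map.
Qed.

Lemma shuffles_map_uniq (f : int -> int) s t :
  {in s ++ t &, injective f} -> uniq (map (map f) (shuffles s t)).
Proof.
move=> fi; rewrite map_inj_in_uniq ?shuffles_uniq //.
have sub g : g \in shuffles s t -> all [in s ++ t] g.
  rewrite mem_shuffles => /and3P[_ _ pg]; apply/allP => x.
  by rewrite (perm_mem pg).
by move=> g h /sub gS /sub hS; apply: (inj_in_map fi).
Qed.

Lemma leq_size_shuffles s t s' t' :
    uniq (s ++ t) -> uniq (s' ++ t') -> size s = size s' -> size t = size t' ->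
  (size (shuffles s t) <= size (shuffles s' t'))%N.
Proof.
move=> u u' szs szt.
have szu : size (s ++ t) = size (s' ++ t') by rewrite !size_cat szs szt.
set f := relabel (s ++ t) (s' ++ t').
have /eqP := map_relabel u szu; rewrite -/f map_cat eqseq_cat ?size_map //.
move=> /andP[/eqP <- /eqP <-]; rewrite -(size_map (map f)).
apply: uniq_leq_size; last exact: shuffles_map_sub.
exact/shuffles_map_uniq/relabel_inj.
Qed.

Lemma size_shuffles s t s' t' :
    uniq (s ++ t) -> uniq (s' ++ t') -> size s = size s' -> size t = size t' ->
  size (shuffles s t) = size (shuffles s' t').
Proof. by move=> *; apply/eqP; rewrite eqn_leq !leq_size_shuffles. Qed.

(** Surjectivity comes for free: the image is a duplicate-free sublist, and both
    sides have the same number of elements. *)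
Lemma shuffles_map (f : int -> int) s t :
    uniq (s ++ t) -> {in s ++ t &, injective f} ->
  perm_eq (map (map f) (shuffles s t)) (shuffles (map f s) (map f t)).
Proof.
move=> u fi; have ui := shuffles_map_uniq fi.
have uf : uniq (map f s ++ map f t) by rewrite -map_cat map_inj_in_uniq.
apply: uniq_perm (shuffles_uniq _ _) _ => //.
have [] := uniq_min_size ui (@shuffles_map_sub f s t); last by [].
by rewrite size_map (size_shuffles uf u) ?size_map.
Qed.

Lemma perm_psi_shuffles_map (f : int -> int) s t :
    uniq (s ++ t) -> {in s ++ t &, {homo f : x y / x < y}} ->
  perm_eq [seq word_psi g | g <- shuffles s t]
          [seq word_psi g | g <- shuffles (map f s) (map f t)].
Proof.
move=> u fi; rewrite perm_sym.
have := perm_map word_psi (shuffles_map u (homo_lt_inj fi)).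
rewrite -map_comp perm_sym => /perm_trans; apply; apply/permP => a.
congr count; apply/eq_in_map => g; rewrite mem_shuffles => /and3P[_ _ pg] /=.
by rewrite word_psi_map // => x y; rewrite !(perm_mem pg); apply: fi.
Qed.

(** * The two kinds of pairs of sizes *)

Lemma psi_shuffles_nseq (c : int) s t :
    {in shuffles s t, forall g, word_psi g = c} ->
  [seq word_psi g | g <- shuffles s t] = nseq (size (shuffles s t)) c.
Proof.
move=> psic; rewrite -[in RHS](size_map word_psi); apply/all_pred1P.
by apply/allP => _ /mapP[g /psic <- ->] /=.
Qed.

Lemma psi_shuffles_trivial s t g :
    ~~ [&& 0 < size s, 0 < size t & size s + size t == 4]%N ->
    g \in shuffles s t ->
  word_psi g = if size s == 0%N then word_psi t
               else if size t == 0%N then word_psi s else 1.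
Proof.
move=> triv; rewrite mem_shuffles => /and3P[sg tg /perm_size].
rewrite size_cat => szg.
have [s0|s0] := eqVneq (size s) 0%N.
  have /eqP -> // : t == g by rewrite -(size_subseq_leqif tg) szg s0.
have [t0|t0] := eqVneq (size t) 0%N.
  have /eqP -> // : s == g by rewrite -(size_subseq_leqif sg) szg t0 addn0.
move: triv; rewrite !lt0n s0 t0 /= => sz4.
by rewrite /word_psi szg (negPf sz4).
Qed.

(** The right-hand side depends on the sizes only, which is what shuffle
    compatibility asks for here, [Psi] being 1 on words of fewer than four
    letters.  Standardizing [s ++ t] leaves 24 words to evaluate. *)
Lemma Lambda_balanced s t :
    uniq (s ++ t) -> (0 < size s)%N -> (0 < size t)%N ->
    (size s + size t)%N = 4%N ->
  perm_eq [seq word_psi g | g <- shuffles s t]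
          (nseq 'C(4, size s)./2 1 ++ nseq 'C(4, size s)./2 (-1)).
Proof.
move=> u s0 t0 sz4; set w := sort <=%R (s ++ t).
have szw : size w = 4%N by rewrite size_sort size_cat.
pose f := relabel w [:: 0; 1; 2; 3].
have fi : {in s ++ t &, {homo f : x y / x < y}}.
  move=> x y xu yu; apply: relabel_sorted_homo; rewrite ?mem_sort //.
  exact/sort_sorted/le_total.
apply: perm_trans (perm_psi_shuffles_map u fi) _.
have pf : map f (s ++ t) \in permutations [:: 0; 1; 2; 3].
  rewrite mem_permutations -(@map_relabel w [:: 0; 1; 2; 3]) ?sort_uniq //.
  by rewrite perm_map // perm_sym perm_sort.
have sk : (size s \in [:: 1; 2; 3])%N.
  have : (size s < 4)%N by rewrite -sz4 -addn1 leq_add2l.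
  by case: (size s) s0 => [|[|[|[|n]]]].
(* Each of the 24 words is cut in all three ways into two nonempty parts. *)
have : all (fun v => all (fun k =>
    perm_eq [seq word_psi g | g <- shuffles (take k v) (drop k v)]
            (nseq 'C(4, k)./2 1 ++ nseq 'C(4, k)./2 (-1)))
    [:: 1; 2; 3]%N) (permutations [:: 0; 1; 2; 3]) by vm_compute.
move=> /allP/(_ _ pf)/allP/(_ _ sk).
by rewrite map_cat take_size_cat ?drop_size_cat ?size_map.
Qed.

Theorem theorem1p5 : permutation_statistic Psi /\ shuffle_compatible Psi.
Proof.
split; first exact: Psi_statistic.
move=> s t s' t' dst dst' szs szt Ps Pt.
have u := disjoint_perm_uniq dst; have u' := disjoint_perm_uniq dst'.
apply: perm_trans (perm_Psi_Sh dst) _; rewrite perm_sym.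
apply: perm_trans (perm_Psi_Sh dst') _; rewrite perm_sym.
have [/and3P[s0 t0 /eqP sz4]|triv] :=
  boolP [&& 0 < size s, 0 < size t & size s + size t == 4]%N.
  apply: perm_trans (Lambda_balanced u s0 t0 sz4) _; rewrite perm_sym szs.
  by apply: Lambda_balanced; rewrite -?szs -?szt.
have triv' := triv; rewrite szs szt in triv'.
rewrite (psi_shuffles_nseq (fun g => psi_shuffles_trivial triv)).
rewrite (psi_shuffles_nseq (fun g => psi_shuffles_trivial triv')).
by rewrite (size_shuffles u u') // -!PsiE Ps Pt szs szt.
Qed.
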